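(* Let $(X,r_X)$, $(Y,r_Y)$ be disjoint solutions of the Yang-Baxter equation, let $(Z,r)$ be a regular extension of them and $U=S(Z,r)$ its associated monoid. Suppose $(X,r_X)$ and $(Y,r_Y)$ are 2-cancellative and $U$ has cancellation on monomials of length $3$. Then $(Z,r)$ obeys the Yang-Baxter equation if and only if the following four conditions hold for all $x,y\in X$, $\alpha,\beta\in Y$: $\mathbf{ml1}$: ${}^{\alpha}({}^{\beta}x)={}^{{}^{\alpha}\beta}({}^{\alpha^{\beta}}x)$; $\mathbf{mr1}$: $(\alpha^x)^y=(\alpha^{{}^xy})^{x^y}$; $\mathbf{ml1a}$: ${}^{\alpha}({}^xy)={}^{{}^{\alpha}x}({}^{\alpha^x}y)$; $\mathbf{mr1a}$: $(\alpha^{\beta})^x=(\alpha^{{}^{\beta}x})^{\beta^x}$.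
   Context: A solution $(X,r_X)$ is a nonempty set $X$ with a bijective map $r_X:X\times X\to X\times X$, written $r_X(x,y)=({}^xy,x^y)$, satisfying the Yang-Baxter equation $r^{12}r^{23}r^{12}=r^{23}r^{12}r^{23}$ on $X^3$; similarly $r_Y(\alpha,\beta)=({}^\alpha\beta,\alpha^\beta)$. A regular extension $(Z,r)$ of disjoint $(X,r_X),(Y,r_Y)$ is $Z=X\sqcup Y$ with a bijection $r:Z\times Z\to Z\times Z$ such that $r|_{X\times X}=r_X$, $r|_{Y\times Y}=r_Y$, $r$ restricts to a bijection $Y\times X\to X\times Y$, written $r(\alpha,x)=({}^\alpha x,\alpha^x)$ (the ground actions ${}^\alpha x\in X$, $\alpha^x\in Y$), and $r|_{X\times Y}=(r|_{Y\times X})^{-1}$. The associated monoid $S(Z,r)$ is generated by $Z$ with defining relations $ab=cd$ whenever $r(a,b)=(c,d)$; it is graded by length. It has cancellation on monomials of length $3$ if for all $a,b,c$ in it with $|a|+|b|=|a|+|c|=3$, each of $ab=ac$ and $ba=ca$ implies $b=c$. $(X,r_X)$ is 2-cancellative if for every positive integer $k$ less than the order of $r_X$ (possibly infinite): $r_X^k(x,y)=(x,z)$ implies $z=y$, and $r_X^k(x,y)=(t,y)$ implies $x=t$. *)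

(* Defs.v *)
(* boolp serves to quotient the words by a possibly undecidable congruence. *)
From HB Require Import structures.
From mathcomp Require Import all_boot boolp.

Set Implicit Arguments.
Unset Strict Implicit.
Unset Printing Implicit Defensive.

Local Open Scope quotient_scope.

(* The actions attached to r : A * B -> C * D by r (a, b) = (^a b, a^b). *)
Definition lact A B C D (r : A * B -> C * D) (a : A) (b : B) : C := (r (a, b)).1.
Definition ract A B C D (r : A * B -> C * D) (a : A) (b : B) : D := (r (a, b)).2.

Definition r12 T (r : T * T -> T * T) (t : T * T * T) : T * T * T :=
  (r t.1, t.2).

Definition r23 T (r : T * T -> T * T) (t : T * T * T) : T * T * T :=
  (t.1.1, (r (t.1.2, t.2)).1, (r (t.1.2, t.2)).2).

Definition yang_baxter T (r : T * T -> T * T) : Prop :=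
  forall t, r12 r (r23 r (r12 r t)) = r23 r (r12 r (r23 r t)).

Record solution T (r : T * T -> T * T) : Prop := Solution {
  solution_nonempty : inhabited T;
  solution_bij : bijective r;
  solution_yang_baxter : yang_baxter r
}.

(* n is the (finite) order of f; f has infinite order when there is no such n. *)
Definition map_order T (f : T -> T) (n : nat) : Prop :=
  [/\ 0 < n, iter n f =1 id &
      forall m, 0 < m -> m < n -> ~ (iter m f =1 id)].

(* "k is less than the order of f", with order +oo allowed *)
Definition below_order T (f : T -> T) (k : nat) : Prop :=
  forall n, map_order f n -> k < n.

Definition two_cancellative T (r : T * T -> T * T) : Prop :=
  forall k, 0 < k -> below_order r k ->
    (forall x y z, iter k r (x, y) = (x, z) -> z = y) /\
    (forall x y t, iter k r (x, y) = (t, y) -> x = t).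

(* The disjoint union of X and Y is X + Y. The map s is the restriction of r to
   Y x X -> X x Y; r determines it, and it carries the ground actions
   ^a x = lact s a x and a^x = ract s a x. *)
Record regular_extension X Y (rX : X * X -> X * X) (rY : Y * Y -> Y * Y)
    (r : (X + Y) * (X + Y) -> (X + Y) * (X + Y)) (s : Y * X -> X * Y) : Prop :=
  RegularExtension {
    regext_bij : bijective r;
    regext_XX : forall x y,
      r (inl x, inl y) = (inl (lact rX x y), inl (ract rX x y));
    regext_YY : forall a b,
      r (inr a, inr b) = (inr (lact rY a b), inr (ract rY a b));
    regext_ground_bij : bijective s;
    regext_YX : forall a x,
      r (inr a, inl x) = (inl (lact s a x), inr (ract s a x));
    regext_XY : forall a x,
      r (inl (lact s a x), inr (ract s a x)) = (inr a, inl x)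
  }.

Section AssociatedMonoid.
Variables (Z : Type) (r : Z * Z -> Z * Z).

Inductive word_congr : seq Z -> seq Z -> Prop :=
| word_congr_rel a b c d : r (a, b) = (c, d) -> word_congr [:: a; b] [:: c; d]
| word_congr_refl u : word_congr u u
| word_congr_sym u v : word_congr u v -> word_congr v u
| word_congr_trans u v w : word_congr u v -> word_congr v w -> word_congr u w
| word_congr_cat u u' v v' :
    word_congr u u' -> word_congr v v' -> word_congr (u ++ v) (u' ++ v').

Definition word_eqv : rel (seq {classic Z}) := fun u v => `[< word_congr u v >].

Lemma word_eqv_refl : reflexive word_eqv.
Proof. by move=> u; apply/asboolP; apply: word_congr_refl. Qed.

Lemma word_eqv_sym : symmetric word_eqv.
Proof. by move=> u v; apply/asboolP/asboolP; apply: word_congr_sym. Qed.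

Lemma word_eqv_trans : transitive word_eqv.
Proof.
by move=> v u w /asboolP uv /asboolP vw; apply/asboolP/(word_congr_trans uv).
Qed.

Canonical word_equiv := EquivRel word_eqv word_eqv_refl word_eqv_sym word_eqv_trans.

Definition assoc_monoid : Type := {eq_quot word_equiv}.

HB.instance Definition _ := Choice.on assoc_monoid.
HB.instance Definition _ := EqQuotient.on assoc_monoid.

Definition word_class (u : seq Z) : assoc_monoid := \pi_assoc_monoid u.

Lemma word_classP u v : word_class u = word_class v <-> word_congr u v.
Proof.
by split=> [/eqmodP/asboolP //|uv]; apply/eqmodP/asboolP.
Qed.

Lemma word_class_repr (a : assoc_monoid) : word_class (repr a) = a.
Proof. exact: reprK. Qed.

Lemma repr_word_class u : word_congr (repr (word_class u)) u.
Proof. by apply/word_classP/word_class_repr. Qed.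

Definition assoc_monoid_mul (a b : assoc_monoid) := word_class (repr a ++ repr b).

Lemma word_class_cat u v :
  word_class (u ++ v) = assoc_monoid_mul (word_class u) (word_class v).
Proof.
apply/word_classP/word_congr_sym.
by apply: word_congr_cat; apply: repr_word_class.
Qed.

Fact assoc_monoid_mulA : associative assoc_monoid_mul.
Proof.
move=> a b c; rewrite -(word_class_repr a) -(word_class_repr b).
by rewrite -(word_class_repr c) -!word_class_cat catA.
Qed.

Fact assoc_monoid_mul1g : left_id (word_class [::]) assoc_monoid_mul.
Proof. by move=> a; rewrite -(word_class_repr a) -word_class_cat. Qed.

Fact assoc_monoid_mulg1 : right_id (word_class [::]) assoc_monoid_mul.
Proof. by move=> a; rewrite -(word_class_repr a) -word_class_cat cats0. Qed.

HB.instance Definition _ := isMonoid.Build assoc_monoid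
  assoc_monoid_mulA assoc_monoid_mul1g assoc_monoid_mulg1.

(* All words in a class have the same length (monoid_length_class). *)
Definition monoid_length (a : assoc_monoid) : nat := size (repr a).

Lemma word_congr_size u v : word_congr u v -> size u = size v.
Proof.
elim=> // [u' v' w' _ -> _ -> //|u1 u2 v1 v2 _ e1 _ e2].
by rewrite !size_cat e1 e2.
Qed.

Lemma monoid_length_class u : monoid_length (word_class u) = size u.
Proof. exact/word_congr_size/repr_word_class. Qed.

End AssociatedMonoid.

Definition length3_cancellation Z (r : Z * Z -> Z * Z) : Prop :=
  forall a b c : assoc_monoid r,
    monoid_length a + monoid_length b = 3 ->
    monoid_length a + monoid_length c = 3 ->
    ((a * b)%g = (a * c)%g -> b = c) /\ ((b * a)%g = (c * a)%g -> b = c).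

Section MatchedPairConditions.
Variables (X Y : Type) (rX : X * X -> X * X) (rY : Y * Y -> Y * Y).
Variable s : Y * X -> X * Y.

Definition ml1 : Prop := forall a b x,
  lact s a (lact s b x) = lact s (lact rY a b) (lact s (ract rY a b) x).

Definition mr1 : Prop := forall a x y,
  ract s (ract s a x) y = ract s (ract s a (lact rX x y)) (ract rX x y).

Definition ml1a : Prop := forall a x y,
  lact s a (lact rX x y) = lact rX (lact s a x) (lact s (ract s a x) y).

Definition mr1a : Prop := forall a b x,
  ract s (ract rY a b) x = ract rY (ract s a (lact s b x)) (ract s b x).

End MatchedPairConditions.

(* Main.v *)
(* Applying r to two adjacent letters of a word does not change its class in U,
   so both sides of the Yang-Baxter equation at (a, b, c) spell the element abc.
   Cancellation in degree 3 then makes the middle letters agree as soon as the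
   outer ones do, and on the triples of type YXX and YYX the four conditions say
   exactly that the outer letters agree. The other mixed types follow by
   conjugation, r being involutive on pairs of mixed type. *)
Require Import Defs.
From mathcomp Require Import all_boot boolp.

Set Implicit Arguments.
Unset Strict Implicit.
Unset Printing Implicit Defensive.

(** The equation is localised at one triple because the eight types of triples over [X + Y] need
    different arguments. *)
Definition yang_baxter_at T (r : T * T -> T * T) t : Prop :=
  r12 r (r23 r (r12 r t)) = r23 r (r12 r (r23 r t)).

(** Where [f] and [g] square to the identity along the orbit of [t], applying them to the braid
    relation moves it to [f t] and [g (f t)]. It serves with [f], [g] being [r12 r] and [r23 r], in
    either order. *)
Lemma conjugate_braid T (f g : T -> T) t :
    f (f t) = t -> g (g (f t)) = f t ->
    f (f (g t)) = g t -> g (g (f (g t))) = f (g t) ->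
    f (g (f t)) = g (f (g t)) ->
  f (g (f (f t))) = g (f (g (f t))) /\
  f (g (f (g (f t)))) = g (f (g (g (f t)))).
Proof.
move=> fft ggft ffgt ggfgt braid.
by rewrite fft ggft braid ggfgt ffgt fft.
Qed.

Section WordCongruence.
Variables (Z : Type) (r : Z * Z -> Z * Z).

Definition word3 (t : Z * Z * Z) : seq Z := [:: t.1.1; t.1.2; t.2].

Lemma word_congr_r12 t : word_congr r (word3 (r12 r t)) (word3 t).
Proof.
case: t => [[a b] c]; apply: word_congr_sym.
apply: (@word_congr_cat _ _ [:: a; b] [:: (r (a, b)).1; (r (a, b)).2] [:: c]).
  by apply: word_congr_rel; case: (r _).
exact: word_congr_refl.
Qed.

Lemma word_congr_r23 t : word_congr r (word3 (r23 r t)) (word3 t).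
Proof.
case: t => [[a b] c]; apply: word_congr_sym.
apply: (@word_congr_cat _ _ [:: a] [:: a] [:: b; c]
          [:: (r (b, c)).1; (r (b, c)).2]); first exact: word_congr_refl.
by apply: word_congr_rel; case: (r _).
Qed.

(** The defining relations rewrite only factors of length two, so none applies to so short a
    word. *)
Lemma word_congr_short u v : word_congr r u v -> size u <= 1 -> u = v.
Proof.
elim=> {u v} // [u v uv IH sv | u v w uv IHu _ IHv su | u u' v v' _ IHu _ IHv].
- by rewrite IH // (word_congr_size uv).
- by rewrite IHu // IHv // -(word_congr_size uv).
rewrite size_cat => uv1; congr (_ ++ _).
- by apply: IHu; apply: leq_trans uv1; apply: leq_addr.
by apply: IHv; apply: leq_trans uv1; apply: leq_addl.
Qed.

Hypothesis canc3 : length3_cancellation r.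

Lemma word_cancel_l u v w : size u + size v = 3 -> size u + size w = 3 ->
  word_congr r (u ++ v) (u ++ w) -> word_congr r v w.
Proof.
move=> sv sw /word_classP; rewrite !word_class_cat => e; apply/word_classP.
have [] := @canc3 (word_class r u) (word_class r v) (word_class r w).
- by rewrite !monoid_length_class.
- by rewrite !monoid_length_class.
by move=> /(_ e).
Qed.

Lemma word_cancel_r u v w : size u + size v = 3 -> size u + size w = 3 ->
  word_congr r (v ++ u) (w ++ u) -> word_congr r v w.
Proof.
move=> sv sw /word_classP; rewrite !word_class_cat => e; apply/word_classP.
have [] := @canc3 (word_class r u) (word_class r v) (word_class r w).
- by rewrite !monoid_length_class.
- by rewrite !monoid_length_class.
by move=> _ /(_ e).
Qed.

Lemma word3_middle_inj a b b' c :
  word_congr r [:: a; b; c] [:: a; b'; c] -> b = b'.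
Proof.
move=> /(@word_cancel_l [:: a] [:: b; c] [:: b'; c] erefl erefl) bc.
(* A further letter c brings the word back to length 3, so that cc cancels. *)
have bcc := word_congr_cat bc (word_congr_refl r [:: c]).
have bb := @word_cancel_r [:: c; c] [:: b] [:: b'] erefl erefl bcc.
by case: (word_congr_short bb isT).
Qed.

Lemma yang_baxter_at_outer t :
    (r12 r (r23 r (r12 r t))).1.1 = (r23 r (r12 r (r23 r t))).1.1 ->
    (r12 r (r23 r (r12 r t))).2 = (r23 r (r12 r (r23 r t))).2 ->
  yang_baxter_at r t.
Proof.
rewrite /yang_baxter_at.
have : word_congr r (word3 (r12 r (r23 r (r12 r t))))
                    (word3 (r23 r (r12 r (r23 r t)))).
  apply: word_congr_trans (word_congr_r12 _) _.
  apply: word_congr_trans (word_congr_r23 _) _.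
  apply: word_congr_trans (word_congr_r12 _) _.
  apply/word_congr_sym.
  apply: word_congr_trans (word_congr_r23 _) _.
  apply: word_congr_trans (word_congr_r12 _) _.
  exact: word_congr_r23.
case: (r12 r _) => [[a b] c]; case: (r23 r _) => [[a' b'] c'].
by rewrite /word3 /= => + aa' cc'; rewrite aa' cc' => /word3_middle_inj ->.
Qed.

End WordCongruence.

(** The cube of [f] intertwines the maps on triples. With [f] being [inl] or [inr] this settles the
    unmixed types. *)
Lemma yang_baxter_at_embed A Z (f : A -> Z) (rA : A * A -> A * A)
    (r : Z * Z -> Z * Z) :
    (forall x y, r (f x, f y) = (f (lact rA x y), f (ract rA x y))) ->
  yang_baxter rA -> forall x y z, yang_baxter_at r (f x, f y, f z).
Proof.
move=> rf ybA x y z; pose F t : Z * Z * Z := (f t.1.1, f t.1.2, f t.2).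
have F12 t : r12 r (F t) = F (r12 rA t).
  by case: t => [[a b] c]; rewrite /r12 /F /= rf.
have F23 t : r23 r (F t) = F (r23 rA t).
  by case: t => [[a b] c]; rewrite /r23 /F /= rf.
by rewrite /yang_baxter_at -[(f x, _, _)]/(F (x, y, z)) !(F12, F23) ybA.
Qed.

Section RegularExtension.
Variables (X Y : Type) (rX : X * X -> X * X) (rY : Y * Y -> Y * Y).
Variables (r : (X + Y) * (X + Y) -> (X + Y) * (X + Y)) (s : Y * X -> X * Y).
Hypothesis ext : regular_extension rX rY r s.

Let rE := (regext_XX ext, regext_YY ext, regext_YX ext, regext_XY ext).

(** This puts an arbitrary pair of type XY into the only form on which [regext_XY] computes [r]. *)
Lemma ground_surj x a : exists b y, x = lact s b y /\ a = ract s b y.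
Proof.
case: (regext_ground_bij ext) => s' _ /(_ (x, a)).
by case: (s' _) => b y sby; exists b, y; rewrite /lact /ract sby.
Qed.

(** Type YYX yields [ml1] from the first letters and [mr1a] from the last ones; type YXX yields
    [ml1a] and [mr1] likewise. *)
Lemma matched_of_yang_baxter :
  yang_baxter r -> [/\ ml1 rY s, mr1 rX s, ml1a rX s & mr1a rY s].
Proof.
move=> yb; split=> [a b x | a x y | a x y | a b x].
- have := yb (inr a, inr b, inl x).
  by rewrite /r12 /r23 /= !rE /= ?rE /= ?rE /= => -[].
- have := yb (inr a, inl x, inl y).
  by rewrite /r12 /r23 /= !rE /= ?rE /= ?rE /= => -[].
- have := yb (inr a, inl x, inl y).
  by rewrite /r12 /r23 /= !rE /= ?rE /= ?rE /= => -[].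
have := yb (inr a, inr b, inl x).
by rewrite /r12 /r23 /= !rE /= ?rE /= ?rE /= => -[].
Qed.

(** Conjugation leads from YXX to XYX and XXY, and from YYX to YXY and XYY. *)
Lemma yang_baxter_of_mixed : yang_baxter rX -> yang_baxter rY ->
    (forall a x y, yang_baxter_at r (inr a, inl x, inl y)) ->
    (forall a b x, yang_baxter_at r (inr a, inr b, inl x)) ->
  yang_baxter r.
Proof.
move=> ybX ybY ybYXX ybYYX.
have conjYXX a x y (t := (inr a, inl x, inl y)) :
    yang_baxter_at r (r12 r t) /\ yang_baxter_at r (r23 r (r12 r t)).
  apply: conjugate_braid (ybYXX a x y);
    by rewrite /r12 /r23 /= !rE /= ?rE /= ?rE.
(* Here the mixed pair stands on the right, so [r23 r] acts first: the two maps swap roles and the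
   braid relation is reversed. *)
have conjYYX a b x (t := (inr a, inr b, inl x)) :
    yang_baxter_at r (r23 r t) /\ yang_baxter_at r (r12 r (r23 r t)).
  have [|||| YXY XYY] := conjugate_braid _ _ _ _ (esym (ybYYX a b x));
    by [rewrite /r12 /r23 /= !rE /= ?rE /= ?rE | split; apply: esym].
have r12YX a x z : r12 r (inr a, inl x, z)
    = (inl (lact s a x), inr (ract s a x), z) by rewrite /r12 /= rE.
have r23YX a x z : r23 r (z, inr a, inl x)
    = (z, inl (lact s a x), inr (ract s a x)) by rewrite /r23 /= rE.
case=> [[[x | a] [y | b]] [z | c]].
- exact: (yang_baxter_at_embed (regext_XX ext) ybX).
(* The letter of [Y] is pulled to the front in two moves, exhibiting the triple as [r23 r (r12 r t)]
   with [t] of type YXX. *)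
- have [b [y' [-> ->]]] := ground_surj y c.
  have [a [x' [-> ->]]] := ground_surj x b.
  by have [_] := conjYXX a x' y'; rewrite r12YX r23YX.
- have [a [x' [-> ->]]] := ground_surj x b.
  by have [] := conjYXX a x' z; rewrite r12YX.
- have [a [x' [-> ->]]] := ground_surj x b.
  have [b' [y' [-> ->]]] := ground_surj x' c.
  by have [_] := conjYYX a b' y'; rewrite r23YX r12YX.
- exact: ybYXX.
- have [b [y' [-> ->]]] := ground_surj y c.
  by have [] := conjYYX a b y'; rewrite r23YX.
- exact: ybYYX.
exact: (yang_baxter_at_embed (regext_YY ext) ybY).
Qed.

Lemma yang_baxter_of_matched : length3_cancellation r ->
    yang_baxter rX -> yang_baxter rY ->
    [/\ ml1 rY s, mr1 rX s, ml1a rX s & mr1a rY s] ->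
  yang_baxter r.
Proof.
move=> canc3 ybX ybY [l1 r1 l1a r1a].
apply: yang_baxter_of_mixed => // [a x y | a b x];
  apply: (yang_baxter_at_outer canc3);
  rewrite /r12 /r23 /= !rE /= ?rE /= ?rE /=.
- by rewrite l1a.
- by rewrite r1.
(* Both sides are iterated actions; fixing [a] keeps the rewrite off the left one. *)
- by rewrite (l1 a).
by rewrite r1a.
Qed.

End RegularExtension.

Theorem theorem4p13 (X Y : Type)
    (rX : X * X -> X * X) (rY : Y * Y -> Y * Y)
    (r : (X + Y) * (X + Y) -> (X + Y) * (X + Y)) (s : Y * X -> X * Y)
    (solX : solution rX) (solY : solution rY)
    (ext : regular_extension rX rY r s)
    (cancX : two_cancellative rX) (cancY : two_cancellative rY)
    (canc3 : length3_cancellation r) :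
  yang_baxter r <-> [/\ ml1 rY s, mr1 rX s, ml1a rX s & mr1a rY s].
Proof.
split; first exact: matched_of_yang_baxter.
exact: yang_baxter_of_matched ext canc3 (solution_yang_baxter solX)
         (solution_yang_baxter solY).
Qed.
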